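(* Let $g,h\ge 2$ be integers. For $x\in[0,1)$ and $n\ge1$ let $A_n(x)$ be the $g$-adic cylinder of rank $n$ containing $x$, and let $m_g^{(h)}(x,n)$ be the largest integer $m\ge 0$ such that $A_n(x)$ is contained in the $h$-adic cylinder $B_m(x)$ of rank $m$ containing $x$. Then for Lebesgue-almost all $x\in[0,1)$, $$\lim_{n\to\infty}\frac{m_g^{(h)}(x,n)}{n}=\frac{\log g}{\log h}.$$
   Context: For an integer $b\ge2$, the $b$-adic cylinders of rank $n\ge 0$ are the intervals $\left[\frac{j}{b^n},\frac{j+1}{b^n}\right)$, $0\le j<b^n$; i.e. the sets of $x\in[0,1)$ with prescribed first $n$ digits in the $b$-adic expansion generated by the map $T_b(x)=bx-\lfloor bx\rfloor$ with digit map $k(x)=\lfloor bx\rfloor$. The rank $0$ cylinder is $[0,1)$. *)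

(* Defs.v *)
From mathcomp Require Import all_boot all_order all_algebra.
From mathcomp Require Import all_classical all_reals all_analysis.
Set Implicit Arguments.
Unset Strict Implicit.
Unset Printing Implicit Defensive.
Import Order.TTheory GRing.Theory Num.Theory.
Import numFieldNormedType.Exports.
Local Open Scope classical_set_scope.
Local Open Scope ring_scope.

Definition cylinder (R : realType) (b n j : nat) : set R :=
  `[j%:R / b%:R ^+ n, j.+1%:R / b%:R ^+ n[%classic.
Arguments cylinder : clear implicits.

(* For x in [0, 1) this union has exactly one member (see cylinder_atE and
   cylinder_inj); for x outside [0, 1) it is empty. *)
Definition cylinder_at (R : realType) (b n : nat) (x : R) : set R :=
  \bigcup_(j in [set j | (j < b ^ n)%N /\ cylinder R b n j x])
    cylinder R b n j.

Definition is_largest (P : set nat) (m : nat) : Prop :=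
  P m /\ forall k, P k -> (k <= m)%N.

(* The default value 0 of xget is not used for x in [0, 1) and g, h >= 2
   (see cyl_depthP). *)
Definition cyl_depth (R : realType) (g h : nat) (x : R) (n : nat) : nat :=
  xget 0%N
    (is_largest [set m | cylinder_at g n x `<=` cylinder_at h m x]).

Section Cylinders.
Context {R : realType}.
Implicit Types (b g h n m j : nat) (x : R).

Lemma cylinderP b n j x : (0 < b)%N -> 0 <= x ->
  cylinder R b n j x <-> Num.truncn (x * b%:R ^+ n) = j.
Proof.
move=> b0 x0; have bn0 : 0 < b%:R ^+ n :> R by rewrite exprn_gt0 ?ltr0n.
rewrite /cylinder /= in_itv /= ler_pdivrMr// ltr_pdivlMr//.
split=> [|<-]; first exact: truncn_def.
by apply: truncn_itv; rewrite mulr_ge0// ltW.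
Qed.

Lemma cylinder_inj b n i j x : (0 < b)%N -> 0 <= x ->
  cylinder R b n i x -> cylinder R b n j x -> i = j.
Proof. by move=> b0 x0 /(cylinderP _ _ b0 x0) <- /(cylinderP _ _ b0 x0). Qed.

Lemma cylinder_atE b n x : (0 < b)%N -> 0 <= x < 1 ->
  cylinder_at b n x = cylinder R b n (Num.truncn (x * b%:R ^+ n)).
Proof.
move=> b0 /andP[x0 x1]; have bn0 : 0 < b%:R ^+ n :> R.
  by rewrite exprn_gt0 ?ltr0n.
have xC : cylinder R b n (Num.truncn (x * b%:R ^+ n)) x.
  exact/(cylinderP _ _ b0 x0).
apply/seteqP; split=> [y [j [_ /(cylinderP _ _ b0 x0) <-]]//|y yC].
exists (Num.truncn (x * b%:R ^+ n)) => //; split=> //.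
rewrite -(ltr_nat R) natrX; apply: le_lt_trans (_ : x * b%:R ^+ n < _).
  by have /andP[] := truncn_itv (mulr_ge0 x0 (ltW bn0)).
by rewrite gtr_pMl.
Qed.

Lemma cylinder_at0 b x : (0 < b)%N -> 0 <= x < 1 ->
  cylinder_at b 0 x = `[0, 1[%classic.
Proof.
move=> b0 x01; rewrite cylinder_atE// expr0 mulr1.
have -> : Num.truncn x = 0%N by apply: truncn_def.
by rewrite /cylinder expr0 !divr1.
Qed.

Lemma sub_cylinder g h n m i j : (0 < g)%N ->
  cylinder R g n i `<=` cylinder R h m j ->
  g%:R ^- n <= h%:R ^- m :> R.
Proof.
move=> g0 AB; have gn0 : 0 < g%:R ^- n :> R.
  by rewrite invr_gt0 exprn_gt0 ?ltr0n.
set a : R := i%:R / g%:R ^+ n; set c : R := j%:R / h%:R ^+ m.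
have ai : i.+1%:R / g%:R ^+ n = a + g%:R ^- n by rewrite /a -natr1 mulrDl div1r.
have cj : j.+1%:R / h%:R ^+ m = c + h%:R ^- m by rewrite /c -natr1 mulrDl div1r.
rewrite /cylinder ai cj -/a -/c in AB.
have /AB/= : `[a, a + g%:R ^- n[%classic a by rewrite /= in_itv/= lexx ltrDl.
rewrite in_itv/= => /andP[ca ac].
rewrite leNgt; apply/negP => hg.
have /AB/= : `[a, a + g%:R ^- n[%classic (c + h%:R ^- m).
  by rewrite /= in_itv/= (ltW ac)/=; apply: ler_ltD.
by rewrite in_itv/= ltxx andbF.
Qed.

Lemma cyl_depthP g h x n : (2 <= g)%N -> (2 <= h)%N -> 0 <= x < 1 ->
  is_largest [set m | cylinder_at g n x `<=` cylinder_at h m x]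
    (cyl_depth g h x n).
Proof.
move=> g2 h2 x01; have [g0 h0] := (ltnW g2, ltnW h2).
apply: xgetPex.
pose P m := `[< cylinder_at g n x `<=` cylinder_at h m x >].
have P0 : exists m, P m.
  exists 0%N; apply/asboolP; rewrite (cylinder_at0 h0)//.
  move=> y [j [+ _]]; rewrite /cylinder /= !in_itv/= => jn.
  have gn0 : 0 < g%:R ^+ n :> R by rewrite exprn_gt0 ?ltr0n.
  move=> /andP[jy yj]; rewrite (le_trans _ jy) ?divr_ge0 ?(ltW gn0)//=.
  by apply: lt_le_trans yj _; rewrite ler_pdivrMr// mul1r -natrX ler_nat.
have Pb m : P m -> (m <= g ^ n)%N.
  move=> /asboolP; rewrite !cylinder_atE// => /(sub_cylinder g0).
  rewrite lef_pV2 ?posrE ?exprn_gt0 ?ltr0n// -!natrX ler_nat.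
  exact/leq_trans/ltnW/ltn_expl.
case: (ex_maxnP P0 Pb) => m /asboolP Pm mmax.
by exists m; split=> // k kP; apply: mmax; apply/asboolP.
Qed.

End Cylinders.

(* Main.v *)
Require Import Defs.
From mathcomp Require Import all_boot all_order all_algebra.
From mathcomp Require Import all_classical all_reals all_analysis.
From mathcomp Require Import measurable_realfun ring lra.
Import Order.TTheory GRing.Theory Num.Theory.
Import numFieldNormedType.Exports.
Local Open Scope classical_set_scope.
Local Open Scope ring_scope.

(** The cylinder of rank n in base g has length g^-n, and a cylinder of rank
    m in base h has length h^-m.  Inclusion forces g^-n <= h^-m, so the depth
    m always satisfies m / n <= ln g / ln h ([cyl_depth_le]).

    For the converse, an interval of length g^-n around x fails to lie in the
    base-h cylinder of rank m around x only when a grid point j / h^m is closer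
    than g^-n to x ([sub_cylinder_at]).  The points x for which this happens
    have measure O(h^m / g^n).  With m the integer part of a n, where
    a < ln g / ln h, this is dominated by a geometric sequence of ratio
    h^a / g < 1, so by Borel-Cantelli almost every x is eventually at depth at
    least a n - 1 ([ae_cyl_depth_ge]).  Letting a increase to ln g / ln h along
    a sequence gives the limit. *)

(** The index runs up to [b ^ m] included because [1] is an endpoint of the last
    cylinder of rank [m]. *)
Definition grid_nbhd {R : realType} (b m : nat) (r : R) : set R :=
  \big[setU/set0]_(j < (b ^ m).+1) ball (j%:R / b%:R ^+ m : R) r.

Lemma measurable_grid_nbhd {R : realType} (b m : nat) (r : R) :
  measurable (grid_nbhd b m r).
Proof. by apply: bigsetU_measurable => j _; exact: measurable_ball. Qed.

Lemma lebesgue_measure_grid_nbhd {R : realType} (b m : nat) (r : R) :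
  0 <= r ->
  (lebesgue_measure (grid_nbhd b m r) <= ((b ^ m).+1%:R * (r *+ 2))%:E)%E.
Proof.
move=> r0.
have := @content_subadditive _ _ _ (@lebesgue_measure R) (grid_nbhd b m r)
  (fun j : nat => ball (j%:R / b%:R ^+ m : R) r) (b ^ m).+1
  (fun j _ => measurable_ball _ _) (measurable_grid_nbhd b m r)
  (@subset_refl _ _).
move/le_trans; apply.
rewrite (eq_bigr (fun=> (r *+ 2)%:E)) => [|j _]; last exact: lebesgue_measure_ball.
by rewrite sumEFin sumr_const card_ord mulr_natl.
Qed.

(** Every point of the base-g cylinder is closer than g^-n to x.  If the two
    endpoints of the base-h cylinder are at distance at least g^-n from x, none
    of them can be crossed. *)
Lemma sub_cylinder_at {R : realType} (g h n m : nat) (x : R) :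
  (0 < g)%N -> (0 < h)%N -> 0 <= x < 1 ->
  ~ grid_nbhd h m (g%:R ^- n) x ->
  cylinder_at g n x `<=` cylinder_at h m x.
Proof.
move=> g0 h0 x01; have /andP[x0 x1] := x01.
rewrite !cylinder_atE//; set i := Num.truncn _; set j := Num.truncn _.
have : cylinder R g n i x by exact/cylinderP.
have : cylinder R h m j x by exact/cylinderP.
have gn0 : 0 < g%:R ^+ n :> R by rewrite exprn_gt0 ?ltr0n.
have hm0 : 0 < h%:R ^+ m :> R by rewrite exprn_gt0 ?ltr0n.
have jh : (j < h ^ m)%N.
  rewrite truncn_lt_nat ?mulr_ge0 ?(ltW hm0)// natrX.
  by rewrite gtr_pMl.
rewrite /cylinder /= !in_itv/= => /andP[jx xj] /andP[ix xi] far.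
have far' k : (k <= h ^ m)%N -> g%:R ^- n <= `|k%:R / h%:R ^+ m - x|.
  move=> kh; rewrite leNgt; apply/negP => kx; apply: far.
  rewrite /grid_nbhd -(bigcup_mkord _ (fun k : nat => ball (k%:R / h%:R ^+ m : R) _)).
  by exists k.
have := far' j (ltnW jh); have := far' j.+1 jh.
rewrite ger0_norm ?subr_ge0 ?(ltW xj)// ler0_norm ?subr_le0// opprB.
move=> xR xL y; rewrite /= !in_itv/= => /andP[iy yi].
move: xi yi; rewrite -natr1 mulrDl div1r => xi yi.
apply/andP; split; lra.
Qed.

Lemma cyl_depth_le {R : realType} (g h n : nat) (x : R) :
  (2 <= g)%N -> (2 <= h)%N -> 0 <= x < 1 ->
  (cyl_depth g h x n)%:R * ln h%:R <= n%:R * ln g%:R :> R.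
Proof.
move=> g2 h2 x01; have [g0 h0] := (ltnW g2, ltnW h2).
have [/= + _] := cyl_depthP n g2 h2 x01.
rewrite !cylinder_atE// => /(sub_cylinder g0).
rewrite lef_pV2 ?posrE ?exprn_gt0 ?ltr0n// => hg.
rewrite !mulr_natl -!lnXn ?ltr0n// ler_ln ?posrE ?exprn_gt0 ?ltr0n//.
Qed.

(** With m the integer part of a n, the grid neighbourhoods of radius g^-n have
    measure at most 2 (h^m + 1) / g^n <= 4 q^n for q = h^a / g < 1, so the
    Borel-Cantelli lemma applies to them. *)
Lemma ae_cyl_depth_ge {R : realType} (g h : nat) (a : R) :
  (2 <= g)%N -> (2 <= h)%N -> 0 <= a -> a * ln h%:R < ln g%:R ->
  {ae @lebesgue_measure R, forall x : R, 0 <= x < 1 ->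
    \forall n \near \oo, (Num.truncn (a * n%:R) <= cyl_depth g h x n)%N}.
Proof.
move=> g2 h2 a0 agh; have [g0 h0] := (ltnW g2, ltnW h2).
pose F n : set R := grid_nbhd h (Num.truncn (a * n%:R)) (g%:R ^- n).
have F0 : lebesgue_measure (lim_sup_set F) = 0%E.
  apply: lim_sup_set_cvg0 => [n|]; first exact: measurable_grid_nbhd.
  (* q = h^a / g *)
  pose q : R := expR (a * ln h%:R - ln g%:R).
  have q0 : 0 <= q := expR_ge0 _.
  have q1 : `|q| < 1 by rewrite ger0_norm// expR_lt1 subr_lt0.
  have muF n : (lebesgue_measure (F n) <= (geometric 4 q n)%:E)%E.
    have gn0 : 0 < g%:R ^- n :> R by rewrite invr_gt0 exprn_gt0 ?ltr0n.
    apply: le_trans (lebesgue_measure_grid_nbhd _ _ _ _) _; first exact: ltW.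
    rewrite lee_fin /=; set m := Num.truncn _.
    have hm1 : 1 <= h%:R ^+ m :> R by rewrite exprn_ege1// ler1n.
    have hm : h%:R ^+ m <= expR (n%:R * (a * ln h%:R)) :> R.
      rewrite -[h%:R in leLHS]lnK ?posrE ?ltr0n// -expRM_natl ler_expR mulrA.
      rewrite ler_wpM2r ?ln_ge0 ?ler1n// (mulrC n%:R).
      by rewrite truncn_le mulr_ge0.
    have -> : q ^+ n = expR (n%:R * (a * ln h%:R)) * g%:R ^- n.
      by rewrite /q -expRM_natl mulrBr expRB [X in _ / X]expRM_natl lnK ?posrE ?ltr0n.
    (* h^m + 1 <= 2 h^m, which explains the constant 4 = 2 * 2 *)
    rewrite -natr1 natrX mulrnAr.
    rewrite (_ : 4 * _ = (2 * expR (n%:R * (a * ln h%:R))) * g%:R ^- n *+ 2).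
      rewrite lerMn2r/= ler_pM2r// mulr_natl mulr2n.
      by rewrite lerD// (le_trans hm1).
    by rewrite -[RHS]mulr_natr; ring.
  apply: (@le_lt_trans _ _ (\sum_(n <oo) (geometric 4 q n)%:E)%E).
    by apply: lee_nneseries => n *; [exact: measure_ge0 | exact: muF].
  rewrite (_ : (fun n => _) = EFin \o series (geometric 4 q)); last first.
    by apply/funext => n; rewrite /= sumEFin.
  by rewrite EFin_lim ?ltry//; exact: is_cvg_geometric_series.
exists (lim_sup_set F); split=> //.
  apply: bigcap_measurable => // n _.
  by apply: bigcup_measurable => k _; exact: measurable_grid_nbhd.
move=> x /=; apply: contra_notP => xF x01.
have [N NF] : exists N, forall n, (N <= n)%N -> ~ F n x.
  move/existsNP: xF => [N /not_implyP[_ NF]]; exists N => n Nn Fx.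
  by apply: NF; exists n.
exists N => // n /= Nn.
have [_] := cyl_depthP n g2 h2 x01; apply => /=.
by apply: sub_cylinder_at => //; exact: NF.
Qed.

Theorem theorem4p9 (R : realType) (g h : nat) (hg : (2 <= g)%N)
    (hh : (2 <= h)%N) :
  {ae @lebesgue_measure R, forall x : R, 0 <= x < 1 ->
    (cyl_depth g h x n)%:R / n%:R @[n --> \oo]
      --> (ln g%:R / ln h%:R : R)}.
Proof.
have lg0 : 0 < ln g%:R :> R by rewrite ln_gt0 ?ltr1n.
have lh0 : 0 < ln h%:R :> R by rewrite ln_gt0 ?ltr1n.
set c := ln g%:R / ln h%:R.
have c0 : 0 < c by rewrite divr_gt0.
(* only countably many rates, so that their exceptional null sets add up to a
   null set *)
pose a k : R := c * (1 - k.+1%:R^-1).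
have a0 k : 0 <= a k by rewrite mulr_ge0 ?(ltW c0)// subr_ge0 invf_le1 ?ler1n.
have ac k : a k * ln h%:R < ln g%:R.
  by rewrite /a mulrAC divfK ?gt_eqF// gtr_pMr// ltrBlDr ltrDl.
have := @ae_foralln _ _ _ (@lebesgue_measure R)
  (fun k x => 0 <= x < 1 -> \forall n \near \oo,
    (Num.truncn (a k * n%:R) <= cyl_depth g h x n)%N)
  (fun k => ae_cyl_depth_ge _ _ _ hg hh (a0 k) (ac k)).
apply: filterS => x depth x01.
apply/cvgrPdist_le => e e0.
(* half of e absorbs the loss c / k.+1 in the rate a k, the other half the
   rounding error 1 / n *)
pose k := Num.truncn (2 * c / e).
have ke : c / k.+1%:R <= e / 2.
  have := truncnS_gt (2 * c / e); rewrite -/k ltr_pdivrMr// => kc.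
  by rewrite ler_pdivrMr//; lra.
near=> n.
have n1 : 2 / e < n%:R by near: n; exact: nbhs_infty_gtr.
have n0 : 0 < n%:R :> R by apply: lt_trans n1; rewrite divr_gt0.
have dn : (Num.truncn (a k * n%:R) <= cyl_depth g h x n)%N.
  by near: n; exact: depth.
have up : (cyl_depth g h x n)%:R / n%:R <= c.
  rewrite ler_pdivrMr// /c mulrAC ler_pdivlMr// [leRHS]mulrC.
  exact: cyl_depth_le.
rewrite ger0_norm ?subr_ge0// lerBlDr -lerBlDl ler_pdivlMr//.
have := truncnS_gt (a k * n%:R); rewrite -natr1.
move: dn; rewrite -(ler_nat R) => dn tr.
have ane : (c - e / 2) * n%:R <= a k * n%:R.
  by rewrite ler_pM2r// /a mulrBr mulr1 lerB.
by move: n1; rewrite ltr_pdivrMr//; lra.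
Unshelve. all: by end_near.
Qed.
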